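(* Let $X$ be an infinite set. (i) $\operatorname{rank}(\mathcal{PB}_X:\mathcal F_X^L)=1$. (ii) If $\alpha\in\mathcal{PB}_X$, then $\mathcal{PB}_X=\langle\mathcal F_X^L\cup\{\alpha\}\rangle$ if and only if $\alpha\in\mathcal G_X^R$ and $\operatorname{codef}(\alpha)=|X|$.
   Context: Partial Brauer monoid. Let $X$ be a set and $X'=\{x':x\in X\}$ a disjoint copy of $X$. A Brauer graph is an (undirected) graph with vertex set $X\cup X'$ in which every vertex has degree at most $1$; $\mathcal{PB}_X$ is the set of all of them. Product: let $X''=\{x'':x\in X\}$ be another disjoint copy of $X$; given $\alpha,\beta\in\mathcal{PB}_X$, let $\alpha^\vee$ be $\alpha$ with each vertex $x'$ renamed $x''$, let $\beta^\wedge$ be $\beta$ with each vertex $x\in X$ renamed $x''$, and let $\Pi(\alpha,\beta)$ be the graph on $X\cup X'\cup X''$ with all edges of $\alpha^\vee$ and $\beta^\wedge$. Then $\alpha\beta$ is the graph on $X\cup X'$ with an edge $\{x,y\}$ whenever $x,y\in X\cup X'$ are distinct and lie in the same connected component of $\Pi(\alpha,\beta)$. This makes $\mathcal{PB}_X$ a monoid with identity the graph with edge set $\{\{x,x'\}:x\in X\}$. A transversal of $\alpha$ is an edge $\{x,y'\}$ with $x,y\in X$ (possibly $x=y$). $\operatorname{Codom}(\alpha)$ is the set of $x\in X$ such that $x'$ belongs to a transversal of $\alpha$, and $\operatorname{codef}(\alpha)=|X\setminus\operatorname{Codom}(\alpha)|$. In a monoid $M$, an element $x$ is a left unit if $ax=1$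 for some $a\in M$, and a right unit if $xb=1$ for some $b\in M$. $\mathcal G_X^L$ and $\mathcal G_X^R$ denote the submonoids of all left units and all right units of $\mathcal{PB}_X$. $\mathcal F_X^L$ denotes the subsemigroup of $\mathcal{PB}_X$ generated by all idempotents of $\mathcal{PB}_X$ together with $\mathcal G_X^L$. For a subset $U$ of a semigroup $S$, $\langle U\rangle$ is the subsemigroup generated by $U$. For $A\subseteq S$, the relative rank is $\operatorname{rank}(S:A)=\min\{|U| : U\subseteq S,\ S=\langle A\cup U\rangle\}$. *)

(* Defs.v *)
From HB Require Import structures.
From mathcomp Require Import all_boot.
From mathcomp Require Import boolp classical_sets functions cardinality.
From Stdlib Require Import Relations.Relation_Operators Relations.Operators_Properties.

Set Implicit Arguments.
Unset Strict Implicit.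
Unset Printing Implicit Defensive.

Local Open Scope classical_set_scope.

(* The vertex set is [X + X]: [inl x] stands for x and [inr x] for x'. *)
Record brauer_graph (X : Type) := BrauerGraph {
  edge : X + X -> X + X -> Prop;
  edge_sym : forall u v, edge u v -> edge v u;
  edge_irrefl : forall u, ~ edge u u;
  edge_deg1 : forall u v w, edge u v -> edge u w -> v = w }.

Lemma brauer_graph_eq (X : Type) (a b : brauer_graph X) :
  (forall u v, edge a u v <-> edge b u v) -> a = b.
Proof.
case: a b => [e s i d] [e' s' i' d'] /= ee'.
have ? : e = e' by apply/funext => u; apply/funext => v; apply/propext.
by subst e'; congr BrauerGraph; exact: Prop_irrelevance.
Qed.

HB.instance Definition _ (X : Type) := gen_eqMixin (brauer_graph X).
HB.instance Definition _ (X : Type) := gen_choiceMixin (brauer_graph X).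

(* [Upper x], [Middle x], [Lower x] stand for x, x'', x' respectively. *)
Inductive layered (X : Type) := Upper of X | Middle of X | Lower of X.

Section ProductGraph.
Variable X : Type.
Implicit Types (a b c : brauer_graph X) (u v w : X + X).

Definition rename_lower u : layered X :=
  match u with inl x => Upper x | inr x => Middle x end.

Definition rename_upper u : layered X :=
  match u with inl x => Middle x | inr x => Lower x end.

Definition outer u : layered X :=
  match u with inl x => Upper x | inr x => Lower x end.

Inductive product_graph a b : layered X -> layered X -> Prop :=
| ProductL u v of edge a u v :
    product_graph a b (rename_lower u) (rename_lower v)
| ProductR u v of edge b u v :
    product_graph a b (rename_upper u) (rename_upper v).

(* [product_graph] is symmetric, so its reflexive transitive closure is the
   relation of lying in the same connected component. *)
Definition product_edge a b u v : Prop :=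
  u <> v /\ clos_refl_trans _ (product_graph a b) (outer u) (outer v).

Lemma clos_rt_sym T (R : T -> T -> Prop) :
  (forall p q, R p q -> R q p) ->
  forall p q, clos_refl_trans _ R p q -> clos_refl_trans _ R q p.
Proof.
move=> sR p q; elim=> {p q} [p q /sR|p|p q r _ qp _ rq].
- exact: rt_step.
- exact: rt_refl.
- exact: rt_trans rq qp.
Qed.

Lemma clos_rt_homo T U (R : T -> T -> Prop) (S : U -> U -> Prop) (h : T -> U) :
  (forall p q, R p q -> clos_refl_trans _ S (h p) (h q)) ->
  forall p q, clos_refl_trans _ R p q -> clos_refl_trans _ S (h p) (h q).
Proof.
move=> RS p q; elim=> {p q} [p q /RS//|p|p q r _ pq _ qr].
- exact: rt_refl.
- exact: rt_trans pq qr.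
Qed.

Lemma product_graph_sym a b p q : product_graph a b p q -> product_graph a b q p.
Proof. by case=> u v /edge_sym; [exact: ProductL|exact: ProductR]. Qed.

Lemma product_edge_sym a b u v : product_edge a b u v -> product_edge a b v u.
Proof.
move=> [uv puv]; split; first by move/esym.
exact: clos_rt_sym (@product_graph_sym a b) _ _ puv.
Qed.

Lemma product_edge_irrefl a b u : ~ product_edge a b u u.
Proof. by case. Qed.

(* Edges of the product graph, coloured by the factor they come from. *)
Let cedge a b (i : bool) (p q : layered X) : Prop :=
  exists u v, [/\ edge (if i then a else b) u v,
    p = (if i then rename_lower else rename_upper) u &
    q = (if i then rename_lower else rename_upper) v].

Let cedge_sym a b i p q : cedge a b i p q -> cedge a b i q p.
Proof. by move=> [u [v [/edge_sym e -> ->]]]; exists v, u. Qed.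

Let cedge_deg1 a b i p q r : cedge a b i p q -> cedge a b i p r -> q = r.
Proof.
move=> [u [v [e -> ->]]] [u' [v' [e' uu' ->]]].
have uu : u = u' by case: i uu' {e e'}; case: u; case: u' => x y //= [->].
by subst u'; rewrite (edge_deg1 e e').
Qed.

Let cedge_outer a b i j u q r :
  cedge a b i (outer u) q -> cedge a b j (outer u) r -> i = j.
Proof.
move=> [w [_ [_ uw _]]] [w' [_ [_ uw' _]]].
by case: i j uw uw' => [] [] //; case: u w w' => x [] y [] z.
Qed.

(* [walk n i p q]: an alternating walk of n.+1 edges from p to q whose last
   edge has colour i. *)
Let walk a b (p : layered X) :=
  fix walk n (i : bool) q : Prop := match n with
  | 0 => cedge a b i p q
  | n.+1 => exists2 r, walk n (~~ i) r & cedge a b i r q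
  end.

Let walk_last a b p n i q : walk a b p n i q -> exists r, cedge a b i r q.
Proof. by case: n => [|n] /= => [?|[r _ ?]]; [exists p|exists r]. Qed.

Let walk_fun a b u n i j q r :
  walk a b (outer u) n i q -> walk a b (outer u) n j r -> i = j /\ q = r.
Proof.
elim: n i j q r => [|n IHn] i j q r /=.
  move=> uq ur; have ij := cedge_outer uq ur; split=> //.
  by apply: cedge_deg1 uq _; rewrite ij.
move=> [q' uq' q'q] [r' ur' r'r].
have [/negb_inj ij q'r'] := IHn _ _ _ _ uq' ur'; split=> //.
by subst j r'; exact: cedge_deg1 q'q r'r.
Qed.

Let walk_reach a b u q : clos_refl_trans _ (product_graph a b) (outer u) q ->
  q = outer u \/ exists n i, walk a b (outer u) n i q.
Proof.
move=> uq0; elim: (clos_rt_rtn1 _ _ _ _ uq0) => {uq0} [|{}q r qr _ IHq]; first by left.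
have {qr} [j qr] : exists j, cedge a b j q r.
  by case: qr => v w e; [exists true|exists false]; exists v, w.
case: IHq => [qu|[n [i uq]]].
  by right; exists 0, j; rewrite /= -qu.
have [ij|/eqP ij] := eqVneq i j; last first.
  right; exists n.+1, j; exists q => //.
  by have <- : i = ~~ j by case: (i) (j) ij => [] [].
subst j; case: n uq => [|n] /= => [uq|[q' uq' q'q]].
  by left; exact: cedge_deg1 qr (cedge_sym uq).
right; exists n, (~~ i).
by rewrite (cedge_deg1 qr (cedge_sym q'q)).
Qed.

Let walk_outer_lt a b u v w n m i j : n < m ->
  walk a b (outer u) n i (outer v) -> walk a b (outer u) m j (outer w) -> False.
Proof.
move=> nm uv uw.
have [k [r [uk vr]]] : exists k r,
    walk a b (outer u) n k r /\ exists q, cedge a b (~~ k) r q.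
  elim: m w j nm uw => // m IHm.
  suff H q j : n < m.+1 -> walk a b (outer u) m.+1 j q ->
      exists k r, walk a b (outer u) n k r /\ exists s, cedge a b (~~ k) r s.
    by move=> w j; exact: H.
  elim: m q j {IHm} => [|m IHm] q j.
    case: n {uv} => // _ [r ur rq]; exists (~~ j), r; split => //.
    by exists q; rewrite negbK.
  rewrite ltnS leq_eqVlt => /predU1P[->|nm] [r ur rq]; last exact: IHm ur.
  by exists (~~ j), r; split => //; exists q; rewrite negbK.
have [ik vE] := walk_fun uv uk; subst k r.
have [r rv] := walk_last uv; have [q vq] := vr.
by have := cedge_outer (cedge_sym rv) vq; case: (i).
Qed.

Let outer_inj u v : outer u = outer v -> u = v.
Proof. by case: u v => x [] y //= [->]. Qed.

Lemma product_edge_deg1 a b u v w :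
  product_edge a b u v -> product_edge a b u w -> v = w.
Proof.
move=> [uv /walk_reach[/outer_inj/esym//|[n [i wv]]]].
move=> [uw /walk_reach[/outer_inj/esym//|[m [j ww]]]].
have [nm|mn|nm] := ltngtP n m.
- by have := walk_outer_lt nm wv ww.
- by have := walk_outer_lt mn ww wv.
- by subst m; apply: outer_inj; case: (walk_fun wv ww).
Qed.

Definition brauer_mul a b : brauer_graph X :=
  BrauerGraph (@product_edge_sym a b) (@product_edge_irrefl a b)
    (@product_edge_deg1 a b).

Definition one_edge u v : Prop :=
  match u, v with
  | inl x, inr y | inr x, inl y => x = y
  | _, _ => False
  end.

Lemma one_edge_sym u v : one_edge u v -> one_edge v u.
Proof. by case: u v => x [] y //=. Qed.

Lemma one_edge_irrefl u : ~ one_edge u u.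
Proof. by case: u => x []. Qed.

Lemma one_edge_deg1 u v w : one_edge u v -> one_edge u w -> v = w.
Proof. by case: u v w => x [] y [] z //= <- <-. Qed.

Definition brauer_one : brauer_graph X :=
  BrauerGraph one_edge_sym one_edge_irrefl one_edge_deg1.

Lemma clos_edge a u v : clos_refl_trans _ (edge a) u v -> u = v \/ edge a u v.
Proof.
elim=> {u v} [u v uv|u|u v w _ uv _ vw]; [by right|by left|].
case: uv vw => [->|uv] // [<-|vw]; [by right|left].
exact: edge_deg1 (edge_sym uv) vw.
Qed.

Lemma brauer_mul1 : left_id brauer_one brauer_mul.
Proof.
move=> a; apply: brauer_graph_eq => u v; split=> [[uv]|e].
  pose h (p : layered X) :=
    match p with Upper x | Middle x => inl x | Lower x => inr x end.
  have hK w : h (outer w) = w by case: w.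
  have H p q : product_graph brauer_one a p q ->
      clos_refl_trans _ (edge a) (h p) (h q).
    case=> u1 v1.
      by case: u1 v1 => x [] y //= ->; exact: rt_refl.
    by case: u1 v1 => x [] y /= e; exact: rt_step.
  by move/(clos_rt_homo H); rewrite !hK => /clos_edge[].
split; first by move=> uv; apply: (@edge_irrefl _ a u); rewrite {2}uv.
have H w : clos_refl_trans _ (product_graph brauer_one a) (outer w)
    (rename_upper w).
  case: w => x; last exact: rt_refl.
  by apply: rt_step; exact: (@ProductL brauer_one a (inl x) (inr x)).
apply: rt_trans (H u) _; apply: rt_trans (rt_step _ _ _ _ (ProductR _ e)) _.
exact: clos_rt_sym (@product_graph_sym _ _) _ _ (H v).
Qed.

Lemma brauer_mulr1 : right_id brauer_one brauer_mul.
Proof.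
move=> a; apply: brauer_graph_eq => u v; split=> [[uv]|e].
  pose h (p : layered X) :=
    match p with Upper x => inl x | Middle x | Lower x => inr x end.
  have hK w : h (outer w) = w by case: w.
  have H p q : product_graph a brauer_one p q ->
      clos_refl_trans _ (edge a) (h p) (h q).
    case=> u1 v1.
      by case: u1 v1 => x [] y /= e; exact: rt_step.
    by case: u1 v1 => x [] y //= ->; exact: rt_refl.
  by move/(clos_rt_homo H); rewrite !hK => /clos_edge[].
split; first by move=> uv; apply: (@edge_irrefl _ a u); rewrite {2}uv.
have H w : clos_refl_trans _ (product_graph a brauer_one) (rename_lower w)
    (outer w).
  case: w => x; first exact: rt_refl.
  by apply: rt_step; exact: (@ProductR a brauer_one (inl x) (inr x)).
apply: rt_trans (clos_rt_sym (@product_graph_sym _ _) (H u)) _.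
by apply: rt_trans (rt_step _ _ _ _ (ProductL _ e)) _.
Qed.

(* For associativity, graphs are placed between numbered copies of X. *)
Let at_ (i j : nat) u : nat * X := match u with inl x => (i, x) | inr x => (j, x) end.

Let placed a i j (p q : nat * X) : Prop :=
  exists u v, [/\ edge a u v, p = at_ i j u & q = at_ i j v].

Let placed2 a b i j k (p q : nat * X) := placed a i j p q \/ placed b j k p q.

Let product_placed a b i j k u v : product_edge a b u v ->
  clos_refl_trans _ (placed2 a b i j k) (at_ i k u) (at_ i k v).
Proof.
move=> [_].
pose h (p : layered X) :=
  match p with Upper x => (i, x) | Middle x => (j, x) | Lower x => (k, x) end.
have hE w : at_ i k w = h (outer w) by case: w.
rewrite !hE; apply: clos_rt_homo => p q pq; apply: rt_step.
by case: pq => {}u {}v e; [left|right]; exists u, v; case: u v e => ? [].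
Qed.

Let placed_product a b i j k u v : uniq [:: i; j; k] ->
  clos_refl_trans _ (placed2 a b i j k) (at_ i k u) (at_ i k v) ->
  u = v \/ product_edge a b u v.
Proof.
move=> /=; rewrite !inE negb_or !andbT => /andP[/andP[ij ik] jk].
pose h (p : nat * X) := if p.1 == i then Upper p.2 else
  if p.1 == j then Middle p.2 else Lower p.2.
have [ji ki kj] : [/\ j == i = false, k == i = false & k == j = false].
  by split; rewrite eq_sym; apply: negbTE.
have hE w : h (at_ i k w) = outer w by case: w => x; rewrite /h /= ?eqxx ?ki ?kj.
have hL w : h (at_ i j w) = rename_lower w.
  by case: w => x; rewrite /h /= ?ji eqxx.
have hR w : h (at_ j k w) = rename_upper w.
  by case: w => x; rewrite /h /= ?ji ?ki ?kj ?eqxx.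
move=> uv; have [->|neq] := pselect (u = v); [by left|right; split => //].
rewrite -!hE; apply: clos_rt_homo uv => p q pq; apply: rt_step.
by case: pq => -[x [y [e -> ->]]]; rewrite ?hL ?hR; [exact: ProductL|exact: ProductR].
Qed.

Let contract (R : nat * X -> nat * X -> Prop) a b i j k p q :
  uniq [:: i; j; k] -> (forall r s, R r s -> r.1 <> j /\ s.1 <> j) ->
  p.1 <> j -> q.1 <> j ->
  clos_refl_trans _ (fun r s => R r s \/ placed2 a b i j k r s) p q <->
  clos_refl_trans _ (fun r s => R r s \/ placed (brauer_mul a b) i k r s) p q.
Proof.
move=> uijk Rj pj qj; split; last first.
  apply: (clos_rt_homo (h := id)) => r s [rs|[u [v [uv -> ->]]]].
    by apply: rt_step; left.
  apply: (clos_rt_homo (h := id)) (product_placed i j k uv) => ? ? ?.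
  by apply: rt_step; right.
set S := fun r s => R r s \/ placed _ i k r s.
have lift r s : r.1 <> j -> s.1 <> j ->
    clos_refl_trans _ (placed2 a b i j k) r s -> clos_refl_trans _ S r s.
  move=> rj sj rs.
  have [rsE|[r' s']] : r = s \/ (r.1 \in [:: i; j; k]) /\ (s.1 \in [:: i; j; k]).
    elim: rs {rj sj} => {r s} [r s rs|r|r s t _ rs _ st]; [right|by left|].
      by case: rs => -[u [v [_ -> ->]]]; split; [case: u|case: v|case: u|case: v] => x;
        rewrite !inE eqxx ?orbT.
    by case: rs st => [->|[? ?]] // [<-|[? ?]]; right.
  - by rewrite rsE; exact: rt_refl.
  have out (t : nat * X) : t.1 \in [:: i; j; k] -> t.1 <> j -> exists u, t = at_ i k u.
    case: t => n x /=; rewrite !inE => /or3P[] /eqP -> // _.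
      by exists (inl x).
    by exists (inr x).
  have [u ru] := out _ r' rj; have [v sv] := out _ s' sj; subst r s.
  have [->|uv] := placed_product uijk rs; first exact: rt_refl.
  by apply: rt_step; right; exists u, v.
move=> pq0; have pq := clos_rt_rtn1 _ _ _ _ pq0.
suff [r [rj pr rq]] : exists r, [/\ r.1 <> j, clos_refl_trans _ S p r &
    clos_refl_trans _ (placed2 a b i j k) r q].
  by apply: rt_trans pr _; exact: lift rq.
elim: pq {qj pq0} => [|{}q s [qs|qs] _ [r [rj pr rq]]].
- by exists p; split => //; exact: rt_refl.
- have [qj sj] := Rj _ _ qs; exists s; split => //; last exact: rt_refl.
  apply: rt_trans pr _; apply: rt_trans (lift _ _ rj qj rq) _.
  by apply: rt_step; left.
- by exists r; split => //; apply: rt_trans rq _; exact: rt_step.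
Qed.

Lemma brauer_mulA : associative brauer_mul.
Proof.
move=> a b c; apply: brauer_graph_eq => u v.
have prodE d e j : uniq [:: 0; j; 3] -> edge (brauer_mul d e) u v <->
    u <> v /\ clos_refl_trans _ (placed2 d e 0 j 3) (at_ 0 3 u) (at_ 0 3 v).
  move=> Uj; split=> [uv|[neq /(placed_product Uj)[]//]].
  by split; [case: uv|exact: product_placed].
have o3 w j : j \in [:: 1; 2] -> (at_ 0 3 w).1 <> j.
  by rewrite !inE => /orP[] /eqP ->; case: w.
have pl d i j k r s : i <> k -> j <> k -> placed d i j r s -> r.1 <> k /\ s.1 <> k.
  by move=> ik jk [x [y [_ -> ->]]]; split; [case: x|case: y].
rewrite (prodE _ _ 1) // (prodE _ _ 2) //.
have c1 := @contract (placed a 0 1) b c 1 2 3 (at_ 0 3 u) (at_ 0 3 v) isT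
  (fun r s => @pl a 0 1 2 r s ltac:(by []) ltac:(by []))
  (o3 u 2 isT) (o3 v 2 isT).
have c2 := @contract (placed c 2 3) a b 0 1 2 (at_ 0 3 u) (at_ 0 3 v) isT
  (fun r s => @pl c 2 3 1 r s ltac:(by []) ltac:(by []))
  (o3 u 1 isT) (o3 v 1 isT).
have sub (S S' : nat * X -> nat * X -> Prop) p q : (forall r s, S r s -> S' r s) ->
    clos_refl_trans _ S p q -> clos_refl_trans _ S' p q.
  by move=> SS'; apply: (clos_rt_homo (h := id)) => r s /SS'; exact: rt_step.
split=> -[neq uv]; split=> //.
  apply: (sub _ _ _ _ _ (c2.1 (sub _ _ _ _ _ (c1.2 uv)))) => r s;
    by rewrite /placed2; tauto.
apply: (sub _ _ _ _ _ (c1.1 (sub _ _ _ _ _ (c2.2 (sub _ _ _ _ _ uv))))) => r s;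
  by rewrite /placed2; tauto.
Qed.

End ProductGraph.

HB.instance Definition _ (X : Type) :=
  isMonoid.Build (brauer_graph X) (@brauer_mulA X) (@brauer_mul1 X) (@brauer_mulr1 X).

Section Semigroups.
Variable S : semigroupType.
Implicit Types A U : set S.

Definition subsemigroup A : Prop :=
  forall x y, A x -> A y -> A (x * y)%g.

Definition generated U : set S := smallest subsemigroup U.

Definition idempotents : set S := [set x | (x * x)%g = x].

(* rank(S : A) is the cardinal of K; cardinals, possibly infinite, are
   represented by sets up to equipotence. *)
Definition relrank_is (T : Type) A (K : set T) : Prop :=
  (exists2 U, generated (A `|` U) = setT & (U #= K)%card) /\
  (forall U, generated (A `|` U) = setT -> (K #<= U)%card).

End Semigroups.

Section Monoids.
Variable M : monoidType.

Definition left_units : set M := [set x | exists a, (a * x)%g = 1%g].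

Definition right_units : set M := [set x | exists b, (x * b)%g = 1%g].

End Monoids.

Arguments idempotents S : clear implicits.
Arguments left_units M : clear implicits.
Arguments right_units M : clear implicits.

Definition Codom (X : Type) (a : brauer_graph X) : set X :=
  [set y | exists x, edge a (inl x) (inr y)].

(* codef(a) is the cardinality of this set. *)
Definition codefect_set (X : Type) (a : brauer_graph X) : set X := ~` Codom a.

Definition FL (X : Type) : set (brauer_graph X) :=
  generated (idempotents (brauer_graph X) `|` left_units (brauer_graph X)).

Arguments FL X : clear implicits.

(* Main.v *)
Require Import Defs.
From mathcomp Require Import all_boot.
From mathcomp Require Import boolp classical_sets functions cardinality.
From Stdlib Require Import Relations.Relation_Operators.

Set Implicit Arguments.
Unset Strict Implicit.
Unset Printing Implicit Defensive.

Local Open Scope classical_set_scope.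
Local Open Scope card_scope.

(** A right unit is a graph whose upper vertices all lie on transversals, and
left units are their mirror images under the involution [star]. The theorem
rests on a factorization and on an invariant.

Factorization ([right_unit_factor]): if [a] is a right unit whose codefect is [|X|], then every [x]
is a product [a * e * l] with [e] idempotent and [l] a left unit. Suppose that
[b] and [r] satisfy [a * b = 1], [r * star r = 1] and [r * b = star x]. Then
[e := b * x * r] is idempotent because [x * star x * x = x], and
[a * e * star r = x]. To get such a pair, split the room left free below [a]
into two copies of [X] and let [c] be the third copy, where [a] sends its
transversals. The graph [r] ([bent x]) sends all its transversals to one of the free
copies and carries the whole of [x], both rows of it, folded onto the lower
vertices of the other two copies. The graph [b] ([unbender]) has transversals from [c] and
upper hooks between the free copies; in [r * b] these hooks pull one row of
[x] back up along the transversals of [r], while the other row falls through.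
This is the zigzag identity that straightens a bent wire
([mul_bent_unbender]).

Invariant ([def_controls_codef]): call a subset of [X] small if [X] does not embed in it. The [x]
such that a small defect forces a small codefect form a subsemigroup that
contains the idempotents and the left units, hence [FL X]. A right unit of
codefect [|X|] has empty defect and is outside this subsemigroup; so something
must be added to [FL X], and a single generator that suffices must itself be
outside, hence have codefect [|X|]. It must be a right unit too: the elements
of any monoid that are left units as soon as they are right units form a
subsemigroup, which contains all idempotents and all left units but not a
right unit of codefect [|X|].

Existence of such a right unit, and closure of small sets under union, use
two facts of cardinal arithmetic: an infinite set contains two disjoint copies
of itself, and any two sets are comparable. Both come from a maximal family of
pairwise disjoint sets. *)

(** * Cardinal arithmetic *)

Lemma card_le_rel T U (A : set T) (B : set U) (r : T -> U -> Prop) :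
  (forall x, A x -> exists2 y, B y & r x y) ->
  (forall x x' y, A x -> A x' -> r x y -> r x' y -> x = x') -> A #<= B.
Proof.
move=> rAB r_inj.
have /choice[f fr] (x : A) : exists y : B, r (val x) (val y).
  have [y By rxy] := rAB _ (set_mem (valP x)).
  by exists (SigSub (mem_set By)).
apply/card_leP/injfunPex; exists f => // x x' _ _ fxx'; apply: val_inj.
apply: (r_inj _ _ (val (f x)) (set_mem (valP x)) (set_mem (valP x'))) => //.
by rewrite fxx'.
Qed.

Lemma card_le_injP T U (A : set T) (B : set U) : A #<= B ->
  exists2 f : A -> U, injective f & forall x, B (f x).
Proof.
move=> /card_leP/injfunPex[f _ f_inj]; exists (val \o f); last first.
  by move=> x; exact: set_mem (valP (f x)).
by apply: inj_comp; [exact: val_inj|move=> x y; apply: f_inj; rewrite inE].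
Qed.

(** A pair [(x, y)] is seen as the two-point set [{x, y}] of the disjoint union,
so that a family of pairwise disjoint pairs is a partial injection; a maximal
one exhausts one of the two sides. *)
Lemma card_le_total T U (A : set T) (B : set U) : A #<= B \/ B #<= A.
Proof.
pose F (p : T * U) : set (T + U) := [set inl p.1; inr p.2].
have [E [EAB /= tE maxE]] := ex_maximal_disjoint_subcollection F (A `*` B).
have [EA|/existsNP[x /not_implyP[Ax Ex]]] :=
    pselect (forall x, A x -> exists2 y, B y & E (x, y)).
  left; apply: card_le_rel EA _ => x x' y _ _ Exy Ex'y.
  suff [] : (x, y) = (x', y) by [].
  by apply: tE => //; exists (inr y); split; right.
have [EB|/existsNP[y /not_implyP[By Ey]]] :=
    pselect (forall y, B y -> exists2 x, A x & E (x, y)).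
  right; apply: card_le_rel EB _ => t t' z _ _ Ezt Ezt'.
  suff [] : (z, t) = (z, t') by [].
  by apply: tE => //; exists (inl z); split; left.
exfalso; apply: (maxE ((x, y) |` E)).
- split; first by move=> q Eq; right.
  by move=> /(_ (x, y) (or_introl erefl)) Exy; apply: Ex; exists y.
- by move=> q [->|/EAB].
- have disj p : E p -> ~ (F (x, y) `&` F p !=set0).
    move=> Ep; have [Ap Bp] := EAB _ Ep.
    case: p Ep Ap Bp => x' y' /= Ep Ax' By' [_ [[] -> [] //= [ee]]].
      by apply: Ex; exists y' => //; rewrite ee.
    by apply: Ey; exists x' => //; rewrite ee.
  move=> p q [->|Ep] [->|Eq] // pq.
  + by case: (disj _ Eq).
  + by case: (disj _ Ep); rewrite setIC.
  + exact: tE.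
Qed.

(** A maximal family of disjoint sequences leaves out a finite set only. Every
point then gets a sequence [f] of the family and an index in it, odd indices
of a fixed sequence [f0] being kept for the points left out; doubling all
indices makes room for a second copy. *)
Lemma infinite_double T : infinite_set [set: T] ->
  exists d : bool -> T -> T,
    forall b c x y, d b x = d c y -> b = c /\ x = y.
Proof.
move=> Tinf; pose F (f : nat -> T) : set T := range f.
have [E [Einj /= tE maxE]] :=
  ex_maximal_disjoint_subcollection F [set f : nat -> T | injective f].
pose V := \bigcup_(f in E) F f.
have Vfin : finite_set (~` V).
  apply: contrapT => /infiniteP/card_le_injP[g g_inj gV].
  pose f n := g (SigSub (mem_set (I : [set: nat] n))).
  have f_inj : injective f by move=> m n /g_inj[].
  have fV n : ~ V (f n) by exact: gV.
  apply: (maxE (f |` E)).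
  - split; first by move=> q Eq; right.
    move=> /(_ f (or_introl erefl)) Ef.
    by apply: (fV 0); exists f => //; exists 0.
  - by move=> q [->|/Einj].
  - have disj h : E h -> ~ (F f `&` F h !=set0).
      by move=> Eh [_ [[n _ <-] hn]]; apply: (fV n); exists h.
    move=> h h' [->|Eh] [->|Eh'] // hh'.
    + by case: (disj _ Eh').
    + by case: (disj _ Eh); rewrite setIC.
    + exact: tE.
have E_inj f g m n : E f -> E g -> f m = g n -> f = g /\ m = n.
  move=> Ef Eg fg; have fgE : f = g.
    by apply: tE => //; exists (f m); split; [exists m|exists n].
  by split=> //; subst g; exact: Einj Ef _ _ fg.
have [f0 Ef0] : E !=set0.
  apply: contrapT => /nonemptyPn E0; apply: Tinf.
  by move: Vfin; rewrite /V E0 bigcup_set0 setC0.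
have /countable_injP[j j_inj] := finite_set_countable Vfin.
have /choice[k kP] x : exists p : (nat -> T) * nat, E p.1 /\
    if `[< V x >] then p.1 p.2./2 = x /\ odd p.2 = false
    else p = (f0, (j x).*2.+1).
  case: asboolP => [[f Ef [n _ fn]]|Vx].
    by exists (f, n.*2); rewrite /= doubleK odd_double.
  by exists (f0, (j x).*2.+1).
have k_inj : injective k.
  move=> x y kxy; have [_ kx] := kP x; have [_ ky] := kP y.
  move: kx ky; rewrite kxy; case: asboolP => Vx; case: asboolP => Vy.
  - by move=> [kx _] [ky _]; rewrite -kx -[RHS]ky.
  - by move=> [_ +] kE; rewrite kE /= odd_double.
  - by move=> kE [_]; rewrite kE /= odd_double.
  - move=> -> [] /double_inj /j_inj; rewrite !inE; exact.
exists (fun b x => (k x).1 (b + (k x).2.*2)) => b c x y.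
have [Ex _] := kP x; have [Ey _] := kP y.
move=> /(E_inj _ _ _ _ Ex Ey)[k1 k2]; split.
  by have := congr1 odd k2; rewrite !oddD !odd_double !addbF !oddb.
apply: k_inj; rewrite (surjective_pairing (k x)) (surjective_pairing (k y)).
congr pair => //; have := congr1 half k2; by rewrite !half_bit_double.
Qed.

(** Compare [A] with [B]; if [A] embeds in [B], then [A `|` B] embeds in the
double of [B]. As [X] is infinite, so is [B], and its double embeds in [B]. *)
Lemma card_le_setU X (A B : set X) : infinite_set [set: X] ->
  [set: X] #<= A `|` B -> [set: X] #<= A \/ [set: X] #<= B.
Proof.
move=> Xinf.
suff absorb (C D : set X) : C #<= D -> [set: X] #<= C `|` D -> [set: X] #<= D.
  have [AB|BA] := card_le_total A B; first by right; exact: absorb AB _.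
  by left; apply: absorb BA _; rewrite setUC.
move=> CD XCD; have Dinf : infinite_set D.
  move=> Dfin; apply: Xinf; apply: card_le_finite XCD _.
  by rewrite finite_setU; split=> //; exact: card_le_finite CD Dfin.
have [|d d_inj] := @infinite_double D; first by rewrite (eq_finite_set (card_setT D)).
have [g g_inj gD] := card_le_injP CD.
apply: card_le_trans XCD _.
pose r x y := (exists2 t : D, x = val t & y = val (d true t)) \/
  ~ D x /\ exists2 s : C, x = val s & y = val (d false (SigSub (mem_set (gD s)))).
apply: (card_le_rel (r := r)).
  move=> x CDx; have [Dx|nDx] := pselect (D x).
    exists (val (d true (SigSub (mem_set Dx)))); first exact: set_valP.
    by left; exists (SigSub (mem_set Dx)).
  have {CDx}Cx : C x by case: CDx.
  exists (val (d false (SigSub (mem_set (gD (SigSub (mem_set Cx))))))).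
    exact: set_valP.
  by right; split=> //; exists (SigSub (mem_set Cx)).
move=> x x' y _ _ [[t -> ->]|[_ [s -> ->]]] [[t' -> /val_inj/d_inj[]//]|].
- by move=> _ ->.
- by move=> [_ [s' -> /val_inj/d_inj[]]].
- by move=> [_ [s' -> /val_inj/d_inj[_ [/g_inj ->]]]].
Qed.

(** * Edges of products *)

Section BrauerGraphs.
Variable X : Type.
Implicit Types (x y z a b : brauer_graph X) (u v w : X + X) (p q : layered X).

Lemma edge_neq x u v : edge x u v -> u <> v.
Proof. by move=> e uv; apply: (@edge_irrefl _ x u); rewrite {2}uv. Qed.

Let linked x y := clos_refl_trans _ (product_graph x y).

Lemma linkedL x y u v : edge x u v -> linked x y (rename_lower u) (rename_lower v).
Proof. by move=> e; apply: rt_step; exact: ProductL. Qed.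

Lemma linkedR x y u v : edge y u v -> linked x y (rename_upper u) (rename_upper v).
Proof. by move=> e; apply: rt_step; exact: ProductR. Qed.

Lemma linked_sym x y p q : linked x y p q -> linked x y q p.
Proof. exact: clos_rt_sym (@product_graph_sym _ _ _) _ _. Qed.

(** The tool for showing that an edge is absent from a product: a set of
vertices closed under the edges of both layers contains the component of each
of its elements. *)
Lemma mul_closed x y (S : set (layered X)) u v :
  (forall s t, edge x s t -> S (rename_lower s) -> S (rename_lower t)) ->
  (forall s t, edge y s t -> S (rename_upper s) -> S (rename_upper t)) ->
  S (outer u) -> edge (x * y)%g u v -> S (outer v).
Proof.
move=> Sx Sy Su [_ uv]; elim: uv Su => [p q []|//|p q r _ pq _ qr /pq/qr//].
- exact: Sx.
- exact: Sy.
Qed.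

Lemma mul_upper x y i j :
  edge x (inl i) (inl j) -> edge (x * y)%g (inl i) (inl j).
Proof.
by move=> e; split; [exact: edge_neq e|exact: linkedL e].
Qed.

Lemma mul_transversal x y i j k : edge x (inl i) (inr j) ->
  edge y (inl j) (inr k) -> edge (x * y)%g (inl i) (inr k).
Proof. by move=> ex ey; split=> //; apply: rt_trans (linkedL y ex) (linkedR x ey). Qed.

Lemma mul_cap x y i j k l : edge x (inl i) (inr k) -> edge y (inl k) (inl l) ->
  edge x (inl j) (inr l) -> edge (x * y)%g (inl i) (inl j).
Proof.
move=> eik ekl ejl; split.
  move=> ij; rewrite -ij in ejl; apply: (edge_neq ekl).
  by have [->] := edge_deg1 eik ejl.
apply: rt_trans (linkedL y eik) (rt_trans _ _ _ _ _ (linkedR x ekl) _).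
exact: linked_sym (linkedL y ejl).
Qed.

Lemma mul_isolated x y i : (forall v, ~ edge x (inl i) v) ->
  forall v, ~ edge (x * y)%g (inl i) v.
Proof.
move=> xi v ev; have : outer v = Upper i.
  apply: (mul_closed (S := [set Upper i])) ev => //= [[s|s]|[s|s]] t e // [si].
  by subst s; case: (xi t).
by case: v ev => // j /edge_neq ij [ji]; apply: ij; rewrite ji.
Qed.

Lemma Dom_mul x y i k : edge (x * y)%g (inl i) (inr k) ->
  exists j, edge x (inl i) (inr j).
Proof.
move=> e; have [[[j ij|j]]|xi] := pselect (exists v, edge x (inl i) v).
- by have := edge_deg1 e (mul_upper y ij).
- by exists j.
- by case: (@mul_isolated x y i _ _ e) => v ev; apply: xi; exists v.
Qed.

(** The component of the upper vertex [i] runs from [j] in the middle row along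
the edge of [y] at [j]. If that edge is a hook to [l] and [l] is on a
transversal of [x], then the component comes back up and [i] is on a hook of
the product. *)
Lemma transversal_mul x y i j k :
  edge (x * y)%g (inl i) (inr k) -> edge x (inl i) (inr j) ->
  (exists l, edge y (inl j) (inr l)) \/
  (exists2 l, edge y (inl j) (inl l) & ~ Codom x l).
Proof.
move=> e ij; have [[[l jl|l jl]]|yj] := pselect (exists v, edge y (inl j) v).
- by right; exists l => // -[i' il]; have := edge_deg1 e (mul_cap ij jl il).
- by left; exists l.
- exfalso; suff [] : (Lower k = Upper i \/ Lower k = Middle j) by [].
  apply: (mul_closed (S := [set Upper i; Middle j])) e; last by left.
    move=> s t + ss; case: s ss => s' [] // [->] e.
      by rewrite (edge_deg1 e ij); right.
    by rewrite (edge_deg1 e (edge_sym ij)); left.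
  move=> s t + ss; case: s ss => s' [] // [->] e.
  by case: yj; exists t.
Qed.

(** * The involution and one-sided units *)

Definition row_swap u : X + X := match u with inl i => inr i | inr i => inl i end.

Lemma row_swapK : involutive row_swap.
Proof. by case. Qed.

Definition star x : brauer_graph X :=
  @BrauerGraph X (fun u v => edge x (row_swap u) (row_swap v))
    (fun u v => @edge_sym _ x _ _) (fun u => @edge_irrefl _ x _)
    (fun u v w e e' => can_inj row_swapK (edge_deg1 e e')).

Lemma starK : involutive star.
Proof. by move=> x; apply: brauer_graph_eq => u v; rewrite /= !row_swapK. Qed.

Lemma star1 : star 1%g = 1%g.
Proof. by apply: brauer_graph_eq => -[] i [] j; split=> //= ->. Qed.

Lemma starM x y : star (x * y)%g = (star y * star x)%g.
Proof.
pose flip p := match p with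
  | Upper i => Lower i | Middle i => Middle i | Lower i => Upper i end.
have flip_outer u : flip (outer u) = outer (row_swap u) by case: u.
have flip_lower u : flip (rename_lower u) = rename_upper (row_swap u) by case: u.
have flip_upper u : flip (rename_upper u) = rename_lower (row_swap u) by case: u.
have sub a b u v : edge (a * b)%g u v ->
    edge (star b * star a)%g (row_swap u) (row_swap v).
  move=> [uv uRv]; split; first by move/(can_inj row_swapK).
  rewrite -!flip_outer; apply: clos_rt_homo uRv => p q [] s t e; apply: rt_step.
    by rewrite !flip_lower; apply: ProductR; rewrite /= !row_swapK.
  by rewrite !flip_upper; apply: ProductL; rewrite /= !row_swapK.
apply: brauer_graph_eq => u v; split.
  by move/sub; rewrite !row_swapK.
by move/sub; rewrite !starK.
Qed.

Lemma mul_lower x y i j :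
  edge y (inr i) (inr j) -> edge (x * y)%g (inr i) (inr j).
Proof. by move=> e; have := @mul_upper (star y) (star x) i j e; rewrite -starM. Qed.

(** As degrees are at most [1], equality needs no study of the components of
vertices that already have an edge; only isolated vertices must be followed. *)
Lemma brauer_eq_sub x y : (forall u v, edge x u v -> edge y u v) ->
  (forall u, (forall v, ~ edge x u v) -> forall v, ~ edge y u v) -> x = y.
Proof.
move=> xy iso; apply: brauer_graph_eq => u v; split; first exact: xy.
move=> uv; have [[w uw]|xu] := pselect (exists w, edge x u w).
  by rewrite (edge_deg1 uv (xy _ _ uw)).
by case: (iso u _ v uv) => w uw; apply: xu; exists w.
Qed.

Lemma mul_starK x : (x * star x * x)%g = x.
Proof.
apply/esym/brauer_eq_sub => [|[] i xi v].
- have tr i j : edge x (inl i) (inr j) -> edge (x * star x * x)%g (inl i) (inr j).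
    by move=> e; apply: mul_transversal (e); apply: mul_transversal (e) _; exact: edge_sym.
  move=> [] i [] j e.
  + by rewrite -mulgA; exact: mul_upper.
  + exact: tr.
  + by apply/edge_sym/tr/edge_sym.
  + exact: mul_lower.
- by rewrite -mulgA; exact: mul_isolated.
- move=> e; apply: (@mul_isolated (star x) (star (x * star x)%g) i _ (row_swap v)).
    by move=> w; exact: xi.
  by rewrite -starM /= row_swapK.
Qed.

Lemma brauer_eq1 x : (forall i, edge x (inl i) (inr i)) -> x = 1%g.
Proof.
move=> x1; apply/esym/brauer_eq_sub => [|u /(_ (row_swap u))[]]; last by case: u.
move=> [] i [] j // ij; rewrite (ij : i = j); [|apply: edge_sym]; exact: x1.
Qed.

Lemma total_mul_star x :
  (forall i, exists j, edge x (inl i) (inr j)) -> (x * star x)%g = 1%g.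
Proof.
move=> xT; apply: brauer_eq1 => i; have [j ij] := xT i.
by apply: mul_transversal (ij) _; exact: edge_sym ij.
Qed.

Lemma right_unitP x :
  right_units (brauer_graph X) x <-> forall i, exists j, edge x (inl i) (inr j).
Proof.
split=> [[y xy] i|xT]; first by apply: (@Dom_mul x y i i); rewrite xy.
by exists (star x); exact: total_mul_star.
Qed.

Lemma star_right_unit x :
  right_units (brauer_graph X) (star x) <-> left_units (brauer_graph X) x.
Proof.
split=> -[y xy]; exists (star y).
  by rewrite -[x]starK -starM xy star1.
by rewrite -starM xy star1.
Qed.

Lemma left_unitP x : left_units (brauer_graph X) x <-> Codom x = [set: X].
Proof.
rewrite -star_right_unit right_unitP; split=> [xT|xT i].
  by apply/seteqP; split=> // i _; have [j e] := xT i; exists j; exact: edge_sym e.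
have [j e] : Codom x i by rewrite xT.
by exists j; exact: edge_sym e.
Qed.

(** * Bending a graph onto the lower row *)

Section Bend.
Variables (z : X -> X) (f : X + X -> X).
Hypotheses (z_inj : injective z) (f_inj : injective f) (zf : forall i u, z i <> f u).

Inductive bend_edge x : X + X -> X + X -> Prop :=
| BendDown i : bend_edge x (inl i) (inr (z i))
| BendUp i : bend_edge x (inr (z i)) (inl i)
| BendHook u v of edge x u v : bend_edge x (inr (f u)) (inr (f v)).

Lemma bend_edge_sym x u v : bend_edge x u v -> bend_edge x v u.
Proof. by case=> [i|i|s t /edge_sym e]; constructor. Qed.

Lemma bend_edge_irrefl x u : ~ bend_edge x u u.
Proof.
suff H v w : bend_edge x v w -> v <> w by move/H.
by case=> [i|i|s t e] // [/f_inj]; exact: edge_neq e.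
Qed.

Lemma bend_edge_deg1 x u v w : bend_edge x u v -> bend_edge x u w -> v = w.
Proof.
case=> [i|i|s t e] e'; inversion e' as [k ki kw|k ki kw|s' t' e'' fs' tw] => //.
- by rewrite (z_inj ki).
- by case: (zf (esym fs')).
- by case: (zf ki).
- by move: e''; rewrite (f_inj fs') => /(edge_deg1 e) ->.
Qed.

Definition bend x : brauer_graph X :=
  BrauerGraph (@bend_edge_sym x) (@bend_edge_irrefl x) (@bend_edge_deg1 x).

Lemma bend_right_unit x : right_units (brauer_graph X) (bend x).
Proof. by apply/right_unitP => i; exists (z i); exact: BendDown. Qed.

Lemma bend_codefect x u : codefect_set (bend x) (f u).
Proof.
by move=> [i e]; inversion e as [k ki kw| |]; case: (zf kw).
Qed.

Lemma bend_hook x u v : edge (bend x) (inr (f u)) v -> exists w, edge x u w.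
Proof.
move=> e; inversion e as [|i zi|s t st fs]; first by case: (zf zi).
by exists t; rewrite -(f_inj fs).
Qed.

End Bend.

Arguments BendDown {z f x}.
Arguments BendUp {z f x}.
Arguments BendHook {z f x u v}.

(** Straightening needs room for three disjoint copies of [X]: one for each row of
[x], and one, [y true], for the lower ends of the transversals of [bent x]. *)
Section Unbend.
Variables (c : X -> X) (y : bool -> X -> X).
Hypotheses (c_inj : injective c).
Hypothesis y_inj : forall s t i j, y s i = y t j -> s = t /\ i = j.
Hypothesis cy : forall i s j, c i <> y s j.

Let legs u := match u with inl i => c i | inr i => y false i end.

Let legs_inj : injective legs.
Proof.
case=> i [] j /= ij.
- by rewrite (c_inj ij).
- by case: (cy ij).
- by case: (cy (esym ij)).
- by have [_ ->] := y_inj ij.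
Qed.

Let pairs u := y (if u is inl _ then true else false) (match u with inl i | inr i => i end).

Let pairs_inj : injective pairs.
Proof. by case=> i [] j /= /y_inj[] // _ ->. Qed.

Let y_true_inj : injective (y true).
Proof. by move=> i j /y_inj[]. Qed.

Let y_legs i u : y true i <> legs u.
Proof. by case: u => j /= ij; [case: (cy (esym ij))|case: (y_inj ij)]. Qed.

Let c_pairs i u : c i <> pairs u.
Proof. exact: cy. Qed.

Definition bent x := bend y_true_inj legs_inj y_legs x.

(** Transversals from [c] down to [X], and one upper hook between the two free
copies for each point: the identity graph folded by [pairs] provides these
hooks. *)
Definition unbender := star (bend c_inj pairs_inj c_pairs 1%g).

Lemma unbender_down i : edge unbender (inl (c i)) (inr i).
Proof. exact: BendUp. Qed.

Lemma unbender_cap i : edge unbender (inl (y true i)) (inl (y false i)).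
Proof. exact: (BendHook (u := inl i) (v := inr i)). Qed.

(** The outer vertex [u] is joined in the product graph to the place [m u] where
[star x] would have it: through [c] if it is a lower vertex, and through
[y true] and then [y false] if it is an upper one. *)
Lemma mul_bent_unbender x : (bent x * unbender)%g = star x.
Proof.
pose r := bent x; pose b := unbender; rewrite -/r -/b.
have bD := unbender_down; have bH := unbender_cap.
pose m u : layered X := Middle (legs (row_swap u)).
have um u : clos_refl_trans _ (product_graph r b) (outer u) (m u).
  case: u => i /=; last by apply: linked_sym; exact: (linkedR r (bD i)).
  apply: rt_trans (linkedL b (_ : edge r (inl i) (inr (y true i)))) _.
    exact: BendDown.
  exact: (linkedR r (bH i)).
apply/esym/brauer_eq_sub => [u v e|u xu v].
  split; first exact: edge_neq e.
  apply: rt_trans (um u) (rt_trans _ _ _ _ _ _ (linked_sym (um v))).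
  have e' : edge r (inr (legs (row_swap u))) (inr (legs (row_swap v))).
    exact: BendHook.
  exact: (linkedL b e').
have xu' w : ~ edge x (row_swap u) w.
  by move=> e; apply: (xu (row_swap w)); rewrite /= row_swapK.
(* An isolated vertex: its component is the path to [m u], which ends there. *)
case: u xu' {xu} => i xi e.
  pose S p := [\/ p = Upper i, p = Middle (y true i) | p = Middle (y false i)].
  suff : S (outer v).
    case: v e => j /edge_neq ij [] // [ji].
    by apply: ij; rewrite ji.
  apply: (@mul_closed r b S _ _ _ _ _ e); last exact: Or31.
    move=> s t st; case: s st => s st [] // [ss]; subst s.
    - by rewrite (edge_deg1 st (BendDown i)); exact: Or32.
    - by rewrite (edge_deg1 st (BendUp i)); exact: Or31.
    - by have [w /xi] := bend_hook (u := inr i) st.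
  move=> s t st; case: s st => s st [] // [ss]; subst s.
    by rewrite (edge_deg1 st (bH i)); exact: Or33.
  by rewrite (edge_deg1 st (edge_sym (bH i))); exact: Or32.
pose S p := p = Lower i \/ p = Middle (c i).
suff : S (outer v).
  case: v e => j /edge_neq ij [] // [ji].
  by apply: ij; rewrite ji.
apply: (@mul_closed r b S _ _ _ _ _ e); last by left.
  move=> s t st; case: s st => s st [] // [ss]; subst s.
  by have [w /xi] := bend_hook (u := inl i) st.
move=> s t st; case: s st => s st [] // [ss]; subst s.
  by rewrite (edge_deg1 st (bD i)); left.
by rewrite (edge_deg1 st (edge_sym (bD i))); right.
Qed.

End Unbend.

Arguments unbender_down {c y c_inj y_inj cy}.

(** * The factorization *)

(** With [b := unbender], [e := b * x * bent x] is idempotent because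
[bent x * b] is [star x], a generalized inverse of [x]. *)
Lemma right_unit_factor x a (y : bool -> X -> X) :
  right_units (brauer_graph X) a ->
  (forall s t i j, y s i = y t j -> s = t /\ i = j) ->
  (forall s i, codefect_set a (y s i)) ->
  exists e r, [/\ (e * e = e)%g, right_units (brauer_graph X) r &
    x = (a * e * star r)%g].
Proof.
move=> /right_unitP/choice[c ac] y_inj ay.
have c_inj : injective c.
  move=> i j cij; have := ac j; rewrite -cij => /edge_sym/(edge_deg1 (edge_sym (ac i))).
  by case.
have cy i s j : c i <> y s j by move=> cij; apply: (ay s j); exists i; rewrite -cij.
pose r := bent c_inj y_inj cy x; pose b := unbender c_inj y_inj cy.
have r_total : forall i, exists j, edge r (inl i) (inr j).
  by apply/right_unitP; exact: bend_right_unit.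
have ab : (a * b)%g = 1%g.
  by apply: brauer_eq1 => i; exact: mul_transversal (ac i) (unbender_down i).
exists (b * x * r)%g, r; split.
- transitivity (b * (x * (r * b) * x) * r)%g; first by rewrite !mulgA.
  by rewrite mul_bent_unbender mul_starK.
- exact/right_unitP.
- by rewrite !mulgA ab mul1g -mulgA total_mul_star // mulg1.
Qed.

End BrauerGraphs.

(** * Generation *)

Lemma generated_subsemigroup (S : semigroupType) (U : set S) :
  subsemigroup (generated U).
Proof. by move=> s t Us Ut A AU; apply: AU.1; [exact: Us|exact: Ut]. Qed.

Lemma generated_setT_sub (S : semigroupType) (A U P : set S) : subsemigroup P ->
  A `<=` P -> U `<=` P -> generated (A `|` U) = [set: S] -> [set: S] `<=` P.
Proof.
by move=> Pmul AP UP <-; apply: smallest_sub => // s [/AP|/UP].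
Qed.

(** If [s * t] is a right unit then so is [s], which is therefore invertible; then
[t] is a right unit, being [s^-1] times a right unit. *)
Lemma right_unit_left_unit_subsemigroup (M : monoidType) :
  subsemigroup [set s : M | right_units M s -> left_units M s].
Proof.
move=> s t sP tP [b stb].
have [c cs] : left_units M s by apply: sP; exists (t * b)%g; rewrite mulgA.
have tbs : (t * (b * s) = 1)%g.
  transitivity (c * (s * t * b) * s)%g; last by rewrite stb mulg1 cs.
  by rewrite !mulgA cs mul1g.
have [e et] : left_units M t by apply: tP; exists (b * s)%g.
by exists (e * c)%g; rewrite -mulgA (mulgA c) cs mul1g.
Qed.

Lemma idempotent_right_unit (M : monoidType) (e : M) :
  idempotents M e -> right_units M e -> e = 1%g.
Proof. by move=> ee [b eb]; rewrite -[LHS]mulg1 -eb mulgA ee. Qed.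

Lemma FL_right_unit_left_unit X : FL X `<=`
  [set x | right_units (brauer_graph X) x -> left_units (brauer_graph X) x].
Proof.
apply: smallest_sub => [|x [xI xR|xL _]].
- exact: right_unit_left_unit_subsemigroup.
- by exists 1%g; rewrite (idempotent_right_unit xI xR) mulg1.
- exact: xL.
Qed.

(** * Defects and codefects *)

Section Defects.
Variable X : Type.
Hypothesis Xinf : infinite_set [set: X].
Implicit Types (x y : brauer_graph X) (A B : set X).
Implicit Types (i j k l : X).

Definition small A : Prop := ~ ([set: X] #<= A).

Lemma small_le A B : A #<= B -> small B -> small A.
Proof. by move=> AB + XA; apply; exact: card_le_trans XA AB. Qed.

Lemma smallU A B : small A -> small B -> small (A `|` B).
Proof. by move=> sA sB /(card_le_setU Xinf)[]. Qed.

(** [codefect_set (star x)] is the complement of the domain of [x], so its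
cardinal is the defect of [x]. *)
Definition def_controls_codef x : Prop :=
  small (codefect_set (star x)) -> small (codefect_set x).

(** Let [x * y] have small defect. Then [x] has small defect, so small codefect.
A point outside the domain of [y] is outside the codomain of [x], or the lower
end of a transversal of [x] whose upper end is outside the domain of [x * y]
(set [P]), or hooked by [y] to a point outside the codomain of [x] (set [L]);
all three are small, so [y] has small defect and small codefect. A point outside the codomain of the product is outside that of
[y] or is joined by [y] to a point outside that of [x] (set [Q]). *)
Lemma def_controls_codef_mul : subsemigroup def_controls_codef.
Proof.
move=> x y xP yP dxy.
have kx : small (codefect_set x).
  apply: xP; apply: small_le dxy; apply: subset_card_le => i xi [j e]; apply: xi.
  have [k ik] := Dom_mul (edge_sym e : edge (x * y)%g (inl i) (inr j)).
  by exists k; exact: edge_sym ik.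
have dy : small (codefect_set (star y)).
  pose L := [set i | exists2 j, codefect_set x j & edge y (inl i) (inl j)].
  pose P := [set i | exists2 j, codefect_set (star (x * y)%g) j & edge x (inl j) (inr i)].
  apply: (@small_le _ (codefect_set x `|` (P `|` L))).
    apply: subset_card_le => i yi; have [[j ji]|xi] := pselect (Codom x i); last by left.
    right; have [[k e]|] := pselect (Codom (star (x * y)%g) j); last by left; exists j.
    have [[l il]|[l il xl]] := transversal_mul (edge_sym e : edge (x * y)%g _ _) ji.
      by case: yi; exists l; exact: edge_sym il.
    by right; exists l.
  apply: smallU => //; apply: smallU.
    apply: small_le dxy; apply: (card_le_rel (r := fun i j => edge x (inl j) (inr i))).
      by move=> i [j]; exists j.
    by move=> i i' j _ _ e e'; have [] := edge_deg1 e e'.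
  apply: small_le kx; apply: (card_le_rel (r := fun i j => edge y (inl i) (inl j))).
    by move=> i [j]; exists j.
  by move=> i i' j _ _ e e'; have [] := edge_deg1 (edge_sym e) (edge_sym e').
have ky := yP dy.
pose Q := [set k | exists2 j, codefect_set x j & edge y (inl j) (inr k)].
apply: (@small_le _ (codefect_set y `|` Q)).
  apply: subset_card_le => k xyk; have [[j jk]|] := pselect (Codom y k); last by left.
  right; exists j => // -[i ij]; apply: xyk; exists i.
  exact: mul_transversal ij jk.
apply: smallU => //; apply: small_le kx.
apply: (card_le_rel (r := fun k j => edge y (inl j) (inr k))) => [k [j]|] //.
  by exists j.
by move=> k k' j _ _ e e'; have [] := edge_deg1 e e'.
Qed.

(** Let [j] be in the domain of [x] but not in its codomain. Its transversal, to
[k] say, must survive in [x * x], where it continues from [j] upwards in the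
first factor; so [j] is on a lower hook of [x], whose other end cannot be in
the domain of [x]. Hence such [j] are at most as many as the points outside the
domain. *)
Lemma def_controls_codef_idempotent x :
  idempotents (brauer_graph X) x -> def_controls_codef x.
Proof.
move=> xx dx; pose D := codefect_set (star x).
have sxx : (star x * star x)%g = star x by rewrite -starM xx.
pose Q := [set k | exists2 j, D j & edge x (inr k) (inr j)].
apply: (@small_le _ (D `|` Q)).
  apply: subset_card_le => j xj; have [[k kj]|] := pselect (Codom (star x) j); last by left.
  right.
  have jk : edge (star x * star x)%g (inl k) (inr j) by rewrite sxx.
  have [[l jl]|[l jl Dl]] := transversal_mul jk kj.
    by case: xj; exists l; exact: edge_sym jl.
  by exists l.
apply: smallU => //; apply: small_le dx.
apply: (card_le_rel (r := fun k j => edge x (inr k) (inr j))) => [k [j]|] //.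
  by exists j.
by move=> k k' j _ _ e e'; have [] := edge_deg1 (edge_sym e) (edge_sym e').
Qed.

Lemma small0 : small set0.
Proof. by move=> /card_le0P X0; apply: Xinf; rewrite X0. Qed.

Lemma FL_def_controls_codef : FL X `<=` def_controls_codef.
Proof.
apply: smallest_sub => [|y [yI|/left_unitP yT _]].
- exact: def_controls_codef_mul.
- exact: def_controls_codef_idempotent.
- by rewrite /codefect_set yT setCT; exact: small0.
Qed.

(** * Generation by one right unit of large codefect *)

Lemma exists_right_unit_large_codefect :
  exists2 a, right_units (brauer_graph X) a & ~ small (codefect_set a).
Proof.
have [d d_inj] := infinite_double Xinf.
pose f u := d false (match u with inl i => d true i | inr i => d false i end).
have d_true_inj : injective (d true) by move=> i j /d_inj[].
have f_inj : injective f.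
  by move=> [] i [] j /d_inj[_ /d_inj[]] // _ ->.
have df i u : d true i <> f u by move=> /d_inj[].
exists (bend d_true_inj f_inj df 1%g); first exact: bend_right_unit.
apply; apply: (card_le_rel (r := fun i j => j = f (inl i))) => [i _|].
  by exists (f (inl i)) => //; exact: bend_codefect.
by move=> i i' j _ _ -> /f_inj[].
Qed.

Lemma right_unit_generates a : right_units (brauer_graph X) a ->
  ~ small (codefect_set a) -> generated (FL X `|` [set a]) = [set: brauer_graph X].
Proof.
move=> aR /contrapT/card_le_injP[h h_inj ha].
have [d d_inj] := infinite_double Xinf.
pose y s i := h (SigSub (mem_set (I : [set: X] (d s i)))).
have y_inj s t i j : y s i = y t j -> s = t /\ i = j.
  by move=> /h_inj[] /d_inj.
have ay s i : codefect_set a (y s i) by exact: ha.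
apply/seteqP; split=> // x _.
have [e [r [ee rR ->]]] := right_unit_factor x aR y_inj ay.
have FLsub : idempotents (brauer_graph X) `|` left_units (brauer_graph X)
    `<=` generated (FL X `|` [set a]).
  by move=> s sU; apply: sub_gen_smallest; left; exact: sub_gen_smallest.
apply: generated_subsemigroup; last first.
  by apply: FLsub; right; apply/star_right_unit; rewrite starK.
apply: generated_subsemigroup; first by apply: sub_gen_smallest; right.
by apply: FLsub; left.
Qed.

End Defects.

Theorem theorem7p1 (X : Type) (Xinf : infinite_set [set: X]) :
  relrank_is (FL X) `I_1 /\
  (forall a : brauer_graph X,
     generated (FL X `|` [set a]) = [set: brauer_graph X] <->
     right_units (brauer_graph X) a /\ (codefect_set a #= [set: X])%card).
Proof.
have [g gR gcodef] := exists_right_unit_large_codefect Xinf.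
have gdef : ~ def_controls_codef g.
  have -> : def_controls_codef g = (small (@set0 X) -> small (codefect_set g)).
    congr (small _ -> _); apply/seteqP; split=> // i [].
    by have /right_unitP/(_ i)[j ij] := gR; exists j; exact: edge_sym ij.
  by move=> /(_ (small0 Xinf)).
have codefE (a : brauer_graph X) : ~ small (codefect_set a) <-> (codefect_set a #= [set: X])%card.
  rewrite card_eq_le; split=> [/contrapT Xa|/andP[_ Xa] //].
  by rewrite card_leT.
have mulP := @def_controls_codef_mul X Xinf; have FLP := @FL_def_controls_codef X Xinf.
split=> [|a].
  split.
    exists [set g]; last exact: card_set1.
    exact: right_unit_generates.
  move=> U gen; have [[u Uu]|/nonemptyPn U0] := pselect (U !=set0).
    by rewrite -(card_le_eql (@card_set1 _ u)); apply: subset_card_le => _ ->.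
  case: gdef; apply: (generated_setT_sub mulP FLP _ gen) => //.
  by rewrite U0.
rewrite -codefE; split=> [gen|[aR acodef]]; last exact: right_unit_generates.
split; last first.
  move=> acodef; apply: gdef; apply: (generated_setT_sub mulP FLP _ gen) => //.
  by move=> _ -> _.
apply: contrapT => aR.
have /left_unitP gL : left_units (brauer_graph X) g.
  apply: (generated_setT_sub (@right_unit_left_unit_subsemigroup _)
    (@FL_right_unit_left_unit X) _ gen) => //.
  by move=> _ -> /aR.
by apply: gcodef; rewrite /codefect_set gL setCT; exact: small0.
Qed.
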